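(* Let $0<r<1$. The density $W_{1,r}$ of the Fuss-Catalan distribution $\mu(1,r)$ with respect to Lebesgue measure is $$W_{1,r}(x)=\frac{\sin(r\pi)}{\pi}\,x^{r-1}(1-x)^{-r}\,\mathbf{1}_{(0,1)}(x).$$ Furthermore, $\mu(1,r)$ is not unimodal for $0<r<1$.
   Context: Fuss-Catalan distributions: for real $p,r$ put $A_0(p,r)=1$ and $A_k(p,r)=\frac{r}{k!}\prod_{i=1}^{k-1}(kp+r-i)$ for $k\ge 1$. For $p\ge 1$, $0<r\le p$, it is known that there is a unique compactly supported Borel probability measure $\mu(p,r)$ on $\mathbb{R}$ with $\int x^k\,\mu(p,r)(dx)=A_k(p,r)$ for all $k\ge 0$. It is the Fuss-Catalan distribution. A measure $\rho$ on $\mathbb{R}$ is unimodal if there are $a\in\mathbb{R}$ (the mode), $c\ge 0$ and a function $f\ge 0$, non-decreasing on $(-\infty,a)$ and non-increasing on $(a,\infty)$, with $\rho(dx)=c\,\delta_a(dx)+f(x)\,dx$. *)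

(* Defs.v *)
From HB Require Import structures.
From mathcomp Require Import all_boot all_order all_algebra.
From mathcomp Require Import all_classical all_reals all_analysis.
Set Implicit Arguments.
Unset Strict Implicit.
Unset Printing Implicit Defensive.
Import Order.TTheory GRing.Theory Num.Theory.
Import numFieldNormedType.Exports.
Local Open Scope classical_set_scope.
Local Open Scope ring_scope.

Definition fuss_catalan_number (R : realType) (p r : R) (k : nat) : R :=
  if k == 0%N then 1
  else r / (k`!)%:R * \prod_(1 <= i < k) (k%:R * p + r - i%:R).

(* Topological support: the smallest closed set of full measure. *)
Definition measure_support (R : realType)
    (mu : {measure set (measurableTypeR R) -> \bar R}) : set R :=
  [set x | forall U : set R, open U -> U x -> (0 < mu U)%E].

(* [mu] is the Fuss-Catalan distribution mu(p, r); when 1 <= p and 0 < r <= p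
   there is exactly one such probability measure. Compactness of the support
   makes all the integrands integrable. *)
Definition is_fuss_catalan (R : realType) (p r : R)
    (mu : probability (measurableTypeR R) R) : Prop :=
  compact (measure_support mu) /\
  forall k : nat, (\int[mu]_x (x ^+ k)%:E = (fuss_catalan_number p r k)%:E)%E.

Definition is_density (R : realType)
    (mu : {measure set (measurableTypeR R) -> \bar R}) (f : R -> R) : Prop :=
  [/\ measurable_fun setT f,
      forall x, 0 <= f x &
      forall A : set (measurableTypeR R), measurable A ->
        (mu A = \int[lebesgue_measure]_(x in A) (f x)%:E)%E].

(* [f] need not be assumed measurable: this follows from the monotonicity
   conditions. *)
Definition unimodal (R : realType)
    (rho : {measure set (measurableTypeR R) -> \bar R}) : Prop :=
  exists (a c : R) (f : R -> R),
    [/\ 0 <= c,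
        forall x, 0 <= f x,
        {in `]-oo, a[ &, {homo f : x y / x <= y}},
        {in `]a, +oo[ &, {homo f : x y / x <= y >-> y <= x}} &
        forall A : set (measurableTypeR R), measurable A ->
          (rho A = c%:E * \d_a A
                   + \int[lebesgue_measure]_(x in A) (f x)%:E)%E].

(* The density W_{1,r}; [`^] is the real power, and the indicator of ]0, 1[
   discards its conventional values at nonpositive bases. *)
Definition W1 (R : realType) (r x : R) : R :=
  sin (r * pi) / pi * x `^ (r - 1) * (1 - x) `^ (- r)
    * \1_(`]0, 1[%classic : set R) x.

(* Main.v *)
Require Import Defs.
From HB Require Import structures.
From mathcomp Require Import all_boot all_order all_algebra.
From mathcomp Require Import all_classical all_reals all_analysis.
From mathcomp Require Import measurable_realfun ring lra.
Set Implicit Arguments.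
Unset Strict Implicit.
Unset Printing Implicit Defensive.
Import Order.TTheory GRing.Theory Num.Theory.
Import numFieldNormedType.Exports.
Local Open Scope classical_set_scope.
Local Open Scope ring_scope.

(* Write B(a, b) for the beta integral over ]0, 1[. Integration by parts gives
   B(a + 1, b) = a / (a + b) B(a, b), so the moments of x^(r-1) (1-x)^(-r) are
   the Fuss-Catalan numbers A_k(1, r) times B(r, 1 - r).

   That B(r, 1 - r) = pi / sin (r pi) is obtained by shifting both parameters
   by n: the weighted AM-GM inequality traps B(n + r, n + 1 - r) between
   n / (2n + 1) B(n, n) and B(n, n) / 2, and the recurrence turns this into
   r B(r, 1 - r) prod_(j <= n) (1 - r^2 / j^2) -> 1. The limit of the product
   is sin (r pi) / (r pi), by the recurrence in n satisfied by the integrals of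
   cos^n t cos (2 r t) over [0, pi / 2].

   Since the even moments are at most 1, mu is carried by [-1, 1], where the
   indicator of ]-oo, a[ is a bounded pointwise limit of polynomials; hence mu
   and the measure of density W_{1,r} have the same distribution function.

   Finally W_{1,r} is unbounded near 0 and near 1, while a unimodal density is
   bounded to the left of any point below the mode and to the right of any
   point above it; and the mode is less than 1 or greater than 0. *)

(** * Beta integrals *)

(** Integration by parts on an open interval, with no finiteness assumed. The fundamental theorem of
    calculus applies on the compact intervals [I n] exhausting []a, b[]. Nonnegativity lets both
    integrals pass to the limit by monotone convergence, possibly to infinity, and the boundary
    terms cancel because [F] has the same limit [l] at both ends. *)
Lemma ge0_integral_derive_diff (R : realType) (F f g : R -> R) (a b l : R) :
  a < b ->
  (forall x, x \in `]a, b[ -> 0 <= f x) ->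
  (forall x, x \in `]a, b[ -> 0 <= g x) ->
  {in `]a, b[, continuous f} -> {in `]a, b[, continuous g} ->
  (forall x, x \in `]a, b[ -> is_derive x 1 F (f x - g x)) ->
  F x @[x --> a^'+] --> l -> F x @[x --> b^'-] --> l ->
  (\int[lebesgue_measure]_(x in `]a, b[) (f x)%:E =
   \int[lebesgue_measure]_(x in `]a, b[) (g x)%:E)%E.
Proof.
move=> ab f0 g0 cf cg dF Fa Fb.
(* With a denominator of at least 3, [2 * e n < b - a], so [[a + e n, b - e n]] is never
   degenerate. *)
pose e n : R := (b - a) / n.+3%:R.
have e0 n : 0 < e n by rewrite divr_gt0// subr_gt0.
have e2 n : e n *+ 2 < b - a.
  rewrite -mulr_natr mulrAC -mulrA gtr_pMr ?subr_gt0//.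
  by rewrite ltr_pdivrMr// mul1r ltr_nat.
have ecvg : e n @[n --> \oo] --> 0.
  rewrite -[X in _ --> X](mulr0 (b - a)).
  apply: cvgM; first exact: cvg_cst.
  have := @cvg_harmonic R; rewrite -(cvg_shiftn 2) /harmonic.
  by under eq_fun do rewrite addn2.
have eh n m : (n <= m)%N -> e m <= e n.
  move=> nm; rewrite ler_pM2l ?subr_gt0// lef_pV2 ?posrE//.
  by rewrite ler_nat !ltnS.
pose I n := `[a + e n, b - e n]%classic.
have Isub n x : I n x -> x \in `]a, b[.
  rewrite /I/= !in_itv/= => /andP[h1 h2]; have := e0 n; lra.
have IU : \bigcup_n I n = `]a, b[%classic.
  rewrite eqEsubset; split => [x [n _ /Isub//]|x/=].
  rewrite in_itv/= => /andP[ax xb].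
  have : \forall n \near \oo, e n < Num.min (x - a) (b - x).
    apply: (cvgr_lt 0 ecvg).
    by rewrite lt_min !subr_gt0 ax.
  move=> [N _ /(_ N (leqnn _))]/=; rewrite lt_min => /andP[h1 h2].
  by exists N => //; rewrite /I/= in_itv/=; lra.
have mh (h : R -> R) : {in `]a, b[, continuous h} -> measurable_fun `]a, b[ h.
  move=> ch; apply: open_continuous_measurable_fun; first exact: interval_open.
  by move=> x /[!inE]; exact: ch.
have cI (h : R -> R) : (forall x, x \in `]a, b[ -> 0 <= h x) ->
    {in `]a, b[, continuous h} ->
    (\int[lebesgue_measure]_(x in I n) (h x)%:E)%E @[n --> \oo] -->
    (\int[lebesgue_measure]_(x in `]a, b[) (h x)%:E)%E.
  move=> h0 ch; rewrite -IU; apply: ge0_nondecreasing_set_cvg_integral.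
  - move=> n m nm; rewrite subsetEset => x; rewrite /I/= !in_itv/=.
    by have := eh _ _ nm; lra.
  - by move=> n; rewrite /I.
  - move=> n; apply/measurable_EFinP.
    by apply: (@measurable_funS _ _ _ _ `]a, b[%classic) (mh _ ch) => // x /Isub.
  - by move=> n x /Isub /h0; rewrite lee_fin.
have wI (h : R -> R) n : {in `]a, b[, continuous h} -> {within I n, continuous h}.
  by move=> ch; apply: continuous_in_subspaceT => x /[!inE] /Isub /ch.
have iI (h : R -> R) n : {in `]a, b[, continuous h} ->
    lebesgue_measure.-integrable (I n) (EFin \o h).
  move=> ch; apply: continuous_compact_integrable; last exact: wI.
  exact: segment_compact.
(* Stated as a sum, so that in the limit no difference of two possibly infinite integrals
   appears. *)
have key n : (\int[lebesgue_measure]_(x in I n) (f x)%:E =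
    (F (b - e n) - F (a + e n))%:E +
    \int[lebesgue_measure]_(x in I n) (g x)%:E)%E.
  have cFx x : x \in `]a, b[ -> {for x, continuous F}.
    move=> /dF [+ _]; move=> /derivable1_diffP; exact: differentiable_continuous.
  have abn : a + e n < b - e n by have := e2 n; lra.
  have := @continuous_FTC2 R (fun x => f x - g x) F _ _ abn.
  rewrite -EFinB => <-; last 3 first.
  - have cfg : {in `]a, b[, continuous (fun x => f x - g x)}.
      by move=> x xab; apply: cvgB; [exact: cf|exact: cg].
    exact: wI.
  - split.
    + move=> x xI; have [] // := dF x.
      by apply: (Isub n); exact: subset_itv_oo_cc xI.
    + apply/cvg_at_right_filter/cFx/(Isub n).
      by rewrite /I/= in_itv/=; lra.
    + apply/cvg_at_left_filter/cFx/(Isub n).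
      by rewrite /I/= in_itv/=; lra.
  - move=> x xI; rewrite derive1E.
    have [|_ ->//] := dF x.
    by apply: (Isub n); exact: subset_itv_oo_cc xI.
  have mI : (@measurable _ (measurableTypeR R)) (I n) by exact: measurable_itv.
  rewrite (@integralB_EFin _ _ _ lebesgue_measure (I n) f g)//; last 2 first.
  - exact: iI.
  - exact: iI.
  rewrite subeK//.
  by apply: (@integrable_fin_num _ _ _ lebesgue_measure (I n)) => //; exact: iI.
suff h : (\int[lebesgue_measure]_(x in I n) (f x)%:E)%E @[n --> \oo] -->
    (\int[lebesgue_measure]_(x in `]a, b[) (g x)%:E)%E.
  exact: (cvg_unique _ (cI f f0 cf) h).
rewrite -[X in _ --> X]add0e (eq_cvg _ _ key); apply: cvgeD => //; last exact: cI.
apply: cvg_EFin; first exact: nearW.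
rewrite -(subrr l) /=.
apply: (@cvgB _ _ _ _ _ (fun n => F (b - e n)) (fun n => F (a + e n))).
  apply: ((cvg_at_leftP _ _ _).1 Fb); split => [n|]; first by rewrite gtrBl.
  by rewrite -[X in _ --> X]subr0; apply: cvgB => //; exact: cvg_cst.
apply: ((cvg_at_rightP _ _ _).1 Fa); split => [n|]; first by rewrite ltrDl.
by rewrite -[X in _ --> X]addr0; apply: cvgD => //; exact: cvg_cst.
Qed.

Definition beta_kernel (R : realType) (a b x : R) : R :=
  x `^ (a - 1) * (1 - x) `^ (b - 1).

Definition beta_integral (R : realType) (a b : R) : R :=
  \int[lebesgue_measure]_(x in `]0, 1[) beta_kernel a b x.

Section beta_kernel.
Context {R : realType}.
Implicit Types a b x : R.

Lemma beta_kernel_ge0 a b x : 0 <= beta_kernel a b x.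
Proof. by rewrite mulr_ge0// powR_ge0. Qed.

Lemma measurable_beta_kernel a b (D : set (measurableTypeR R)) :
  measurable_fun D (beta_kernel a b).
Proof.
apply: measurable_funTS; apply: measurable_funM.
  exact: measurable_powR.
apply: (@measurableT_comp _ _ _ _ _ _ (@powR R ^~ (b - 1))) => //.
by apply: measurable_funB.
Qed.

Lemma powR_continuous a x : 0 < x -> {for x, continuous (@powR R ^~ a)}.
Proof.
move=> x0; apply/differentiable_continuous/derivable1_diffP.
by apply: derivable_powR; rewrite in_itv/= x0.
Qed.

Lemma powR_onem_continuous a x : x < 1 ->
  {for x, continuous (fun y : R => (1 - y) `^ a)}.
Proof.
move=> x1; apply: (@continuous_comp _ _ _ (fun y : R => 1 - y) (@powR R ^~ a)).
  by apply: cvgB; [exact: cvg_cst|exact: cvg_id].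
by apply: powR_continuous; rewrite subr_gt0.
Qed.

Lemma beta_kernel_continuous a b :
  {in `]0, 1[, continuous (beta_kernel a b)}.
Proof.
move=> x; rewrite in_itv/= => /andP[x0 x1]; apply: cvgM.
  exact: powR_continuous.
exact: powR_onem_continuous.
Qed.

Lemma is_derive_beta_kernel a b x : x \in `]0, 1[ ->
  is_derive x 1 (beta_kernel (a + 1) (b + 1))
    (a * beta_kernel a (b + 1) x - b * beta_kernel (a + 1) b x).
Proof.
rewrite in_itv/= => /andP[x0 x1].
have d1 : is_derive x 1 (fun y : R => y `^ a) (a * x `^ (a - 1)).
  exact: is_derive1_powR.
have d2 : is_derive x 1 (fun y : R => (1 - y) `^ b) (- (b * (1 - x) `^ (b - 1))).
  have h : is_derive (1 - x) 1 (@powR R ^~ b) (b * (1 - x) `^ (b - 1)).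
    by apply: is_derive1_powR; rewrite subr_gt0.
  have h' : is_derive x 1 (fun y : R => 1 - y) (- 1 : R).
    by rewrite -[X in is_derive _ _ _ X]sub0r; exact: is_deriveB.
  rewrite -[X in is_derive _ _ _ X]mulrN1.
  exact: (@is_derive1_comp _ (@powR R ^~ b) (fun y : R => 1 - y) x _ _ h h').
rewrite /beta_kernel !addrK.
by apply: is_derive_eq; rewrite /GRing.scale/=; ring.
Qed.

Lemma cvg_beta_kernel_at0 a b : 0 < a ->
  beta_kernel (a + 1) b x @[x --> 0^'+] --> 0.
Proof.
move=> a0; rewrite -[X in _ --> X](mul0r (1 `^ (b - 1))).
apply: cvgM; first by rewrite addrK; exact: powR_cvg0.
apply: cvg_at_right_filter.
by have := @powR_onem_continuous (b - 1) 0 ltr01; rewrite /prop_for /continuous_at subr0.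
Qed.

Lemma cvg_beta_kernel_at1 a b : 0 < b ->
  beta_kernel a (b + 1) x @[x --> 1^'-] --> 0.
Proof.
move=> b0; rewrite -[X in _ --> X](mulr0 (1 `^ (a - 1))).
apply: cvgM; first exact/cvg_at_left_filter/powR_continuous.
rewrite addrK; apply/cvg_at_leftP => u [u1 ucvg].
apply: ((cvg_at_rightP (@powR R ^~ b) 0 0).1 (powR_cvg0 b0) (fun n => 1 - u n)).
split=> [n|]; first by rewrite subr_gt0.
by rewrite -(subrr 1); apply: cvgB => //; exact: cvg_cst.
Qed.

(** The extended-real integral: its recurrences hold before finiteness is known, and finiteness is
    then deduced from them. *)
Let E a b : \bar R :=
  (\int[lebesgue_measure]_(x in `]0%R, 1%R[) (beta_kernel a b x)%:E)%E.

Let E_ge0 a b : (0 <= E a b)%E.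
Proof. by apply: integral_ge0 => x _; rewrite lee_fin beta_kernel_ge0. Qed.

Let E_parts a b : 0 < a -> 0 < b ->
  (a%:E * E a (b + 1) = b%:E * E (a + 1) b)%E.
Proof.
move=> a0 b0.
rewrite /E -!ge0_integralZl_EFin//=; last 6 first.
- by move=> x _; rewrite lee_fin beta_kernel_ge0.
- by apply/measurable_EFinP; exact: measurable_beta_kernel.
- exact: ltW.
- by move=> x _; rewrite lee_fin beta_kernel_ge0.
- by apply/measurable_EFinP; exact: measurable_beta_kernel.
- exact: ltW.
apply: (@ge0_integral_derive_diff R (beta_kernel (a + 1) (b + 1))
  (fun x => a * beta_kernel a (b + 1) x)
  (fun x => b * beta_kernel (a + 1) b x) 0 1 0).
- exact: ltr01.
- by move=> x _; rewrite mulr_ge0 ?beta_kernel_ge0// ltW.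
- by move=> x _; rewrite mulr_ge0 ?beta_kernel_ge0// ltW.
- by move=> x x01; apply: cvgM; [exact: cvg_cst|exact: beta_kernel_continuous].
- by move=> x x01; apply: cvgM; [exact: cvg_cst|exact: beta_kernel_continuous].
- by move=> x; exact: is_derive_beta_kernel.
- exact: cvg_beta_kernel_at0.
- exact: cvg_beta_kernel_at1.
Qed.

Lemma powRS x a : 0 < x -> x `^ (a + 1) = x `^ a * x.
Proof.
by move=> x0; rewrite powRD ?(gt_eqF x0) ?implybT// powRr1// ltW.
Qed.

Lemma beta_kernelSl a b x : 0 < x < 1 ->
  beta_kernel (a + 1) b x = beta_kernel a b x * x.
Proof.
by move=> /andP[x0 x1]; rewrite /beta_kernel addrAC powRS//; ring.
Qed.

Lemma beta_kernelSr a b x : 0 < x < 1 ->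
  beta_kernel a (b + 1) x = beta_kernel a b x * (1 - x).
Proof.
move=> /andP[x0 x1]; rewrite /beta_kernel [b + 1 - 1]addrAC powRS ?subr_gt0//.
ring.
Qed.

Lemma beta_kernelD a b x : 0 < x < 1 ->
  beta_kernel a b x = beta_kernel (a + 1) b x + beta_kernel a (b + 1) x.
Proof. by move=> x01; rewrite beta_kernelSl// beta_kernelSr//; ring. Qed.

Let E_add a b : E a b = (E (a + 1) b + E a (b + 1))%E.
Proof.
rewrite /E -ge0_integralD//; last 4 first.
- by move=> x _; rewrite lee_fin beta_kernel_ge0.
- by apply/measurable_EFinP; exact: measurable_beta_kernel.
- by move=> x _; rewrite lee_fin beta_kernel_ge0.
- by apply/measurable_EFinP; exact: measurable_beta_kernel.
apply: eq_integral => x; rewrite inE/= in_itv/= => x01.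
by rewrite -EFinD -beta_kernelD.
Qed.

(** [E (a + 1) (b + 1)] is at most 1, since its kernel is bounded by 1. Integration by parts carries
    finiteness between [E c (d + 1)] and [E (c + 1) d], and the splitting 1 = x + (1 - x) in [E_add]
    lowers the parameters one at a time. *)
Let E_fin a b : 0 < a -> 0 < b -> (E a b < +oo)%E.
Proof.
move=> a0 b0.
have fin0 : (E (a + 1) (b + 1) < +oo)%E.
  apply: (@le_lt_trans _ _ (\int[lebesgue_measure]_(x in `]0%R, 1%R[) (cst 1 x))%E).
    apply: ge0_le_integral => //.
    - by move=> x _; rewrite lee_fin beta_kernel_ge0.
    - by apply/measurable_EFinP; exact: measurable_beta_kernel.
    - move=> x; rewrite /= in_itv/= => /andP[x0 x1].
      rewrite lee_fin /beta_kernel !addrK mulr_ile1 ?powR_ge0//.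
        by rewrite -[leRHS](powRr0 x); apply: ger_powR; rewrite ?x0 ltW.
      rewrite -[leRHS](powRr0 (1 - x)); apply: ger_powR; last exact: ltW.
      by rewrite subr_gt0 x1 gerBl ltW.
  by rewrite integral_cst//= lebesgue_measure_itv/= lte_fin ltr01 mul1e -EFinB ltry.
have step c d : 0 < c -> 0 < d -> (E c (d + 1) < +oo -> E (c + 1) d < +oo)%E.
  move=> c0 d0; rewrite !ltey => h; apply: contra_neq h => h.
  have := E_parts c0 d0; rewrite h gt0_muley ?lte_fin//.
  have := E_ge0 c (d + 1); case: (E c (d + 1)) => [s|//|//].
  by rewrite -EFinM.
have fin1 : (E (a + 1) b < +oo)%E.
  rewrite E_add lte_add_pinfty//.
  by apply: step => //; lra.
have fin2 : (E a (b + 1) < +oo)%E.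
  rewrite ltey; apply/negP => /eqP h.
  have := E_parts a0 b0; rewrite h gt0_muley ?lte_fin//.
  have := E_ge0 (a + 1) b; move: fin1; case: (E (a + 1) b) => [s|//|//].
  by rewrite -EFinM.
by rewrite E_add lte_add_pinfty.
Qed.

Lemma integrable_beta_kernel a b : 0 < a -> 0 < b ->
  (@lebesgue_measure R).-integrable `]0, 1[ (EFin \o beta_kernel a b).
Proof.
move=> a0 b0; apply/integrableP; split.
  by apply/measurable_EFinP; exact: measurable_beta_kernel.
have := E_fin a0 b0; congr (_ < _)%E; apply: eq_integral => x _.
by rewrite /= ger0_norm ?beta_kernel_ge0.
Qed.

Lemma EFin_beta_integral a b : 0 < a -> 0 < b ->
  (beta_integral a b)%:E =
  (\int[lebesgue_measure]_(x in `]0%R, 1%R[) (beta_kernel a b x)%:E)%E.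
Proof.
move=> a0 b0; rewrite /beta_integral /Rintegral fineK// ge0_fin_numE.
  exact: E_fin.
exact: E_ge0.
Qed.

Lemma beta_integral_parts a b : 0 < a -> 0 < b ->
  a * beta_integral a (b + 1) = b * beta_integral (a + 1) b.
Proof.
move=> a0 b0; apply: EFin_inj.
by rewrite !EFinM !EFin_beta_integral ?E_parts// addr_gt0.
Qed.

Lemma beta_integralD a b : 0 < a -> 0 < b ->
  beta_integral a b = beta_integral (a + 1) b + beta_integral a (b + 1).
Proof.
move=> a0 b0; apply: EFin_inj.
by rewrite !EFinD !EFin_beta_integral -?E_add// addr_gt0.
Qed.

Lemma beta_integralSl a b : 0 < a -> 0 < b ->
  beta_integral (a + 1) b = a / (a + b) * beta_integral a b.
Proof.
move=> a0 b0; rewrite (beta_integralD a0 b0).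
have := beta_integral_parts a0 b0.
have ab : a + b != 0 by rewrite gt_eqF// addr_gt0.
move=> h; apply: (mulfI ab); rewrite [RHS]mulrA [_ * (a / _)]mulrC divfK//.
by rewrite mulrDr h; ring.
Qed.

Lemma beta_integralSr a b : 0 < a -> 0 < b ->
  beta_integral a (b + 1) = b / (a + b) * beta_integral a b.
Proof.
move=> a0 b0; have := beta_integralD a0 b0; rewrite beta_integralSl//.
have ab : a + b != 0 by rewrite gt_eqF// addr_gt0.
move=> h; apply: (addrI (a / (a + b) * beta_integral a b)).
by rewrite -h; field.
Qed.

Lemma beta_integral11 : beta_integral 1 1 = 1 :> R.
Proof.
apply: EFin_inj; rewrite EFin_beta_integral//.
under eq_integral do rewrite /beta_kernel subrr !powRr0 mulr1.
by rewrite integral_cst//= lebesgue_measure_itv/= lte_fin ltr01 mul1e -EFinB subr0.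
Qed.

End beta_kernel.

(** * Euler's product for the sine *)

Section continuous_Rintegral.
Context {R : realType}.
Implicit Types (f g F : R -> R) (a b : R).
Local Notation mu := (@lebesgue_measure R).

Lemma continuous_itv_integrable f a b : continuous f ->
  mu.-integrable `[a, b] (EFin \o f).
Proof.
move=> cf; apply: continuous_compact_integrable; first exact: segment_compact.
exact: continuous_subspaceT.
Qed.

Lemma Rintegral_derive F f a b : a < b -> continuous f ->
  (forall x : R, is_derive x 1 F (f x)) ->
  \int[mu]_(x in `[a, b]) f x = F b - F a.
Proof.
move=> ab cf dF.
have cF x : {for x, continuous F}.
  apply/differentiable_continuous/derivable1_diffP.
  by have [] := dF x.
rewrite /Rintegral (@continuous_FTC2 _ f F)// ?fineK//.
- exact: continuous_subspaceT.
- split; first by move=> x _; have [] := dF x.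
  + exact/cvg_at_right_filter/cF.
  + exact/cvg_at_left_filter/cF.
- by move=> x _; rewrite derive1E; have [_ ->] := dF x.
Qed.

End continuous_Rintegral.

Section wallis.
Context {R : realType}.
Implicit Types (r t x u : R) (n : nat).
Local Notation mu := (@lebesgue_measure R).

(** For r = 0 these are the Wallis integrals of cos^n. The frequency 2 r is chosen so that the value
    at n = 0 is sin (r pi) / (2 r) when r is nonzero. *)
Definition wallis r n : R :=
  \int[mu]_(t in `[0, pi / 2]) (cos t ^+ n * cos (2 * r * t)).

Lemma continuous_wallis r n :
  continuous (fun t : R => cos t ^+ n * cos (2 * r * t)).
Proof.
move=> t; apply: cvgM.
  by apply: (@continuous_comp _ _ _ (@cos R) (fun y => y ^+ n));
    [exact: continuous_cos|exact: exprn_continuous].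
apply: (@continuous_comp _ _ _ (fun t => 2 * r * t) (@cos R));
  last exact: continuous_cos.
by apply: cvgM; [exact: cvg_cst|exact: cvg_id].
Qed.

Lemma is_derive_cosM r t :
  is_derive t 1 (fun t => cos (2 * r * t)) (- (2 * r) * sin (2 * r * t)).
Proof.
have h : is_derive t 1 (fun t : R => 2 * r * t) (2 * r).
  by apply: is_derive_eq; rewrite /GRing.scale/=; ring.
rewrite (_ : _ * sin _ = - sin (2 * r * t) * (2 * r)); last by ring.
exact: (@is_derive1_comp R (@cos R) _ t _ _ (is_derive_cos _) h).
Qed.

Lemma is_derive_sinM r t :
  is_derive t 1 (fun t => sin (2 * r * t)) (2 * r * cos (2 * r * t)).
Proof.
have h : is_derive t 1 (fun t : R => 2 * r * t) (2 * r).
  by apply: is_derive_eq; rewrite /GRing.scale/=; ring.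
rewrite (_ : _ * cos _ = cos (2 * r * t) * (2 * r)); last by rewrite mulrC.
exact: (@is_derive1_comp R (@sin R) _ t _ _ (is_derive_sin _) h).
Qed.

Lemma is_derive_cosX n t :
  is_derive t 1 (fun t : R => cos t ^+ n.+1) (- n.+1%:R * (cos t ^+ n * sin t)).
Proof.
rewrite (_ : (fun t : R => _) = @cos R ^+ n.+1); last first.
  by apply/funext => x; rewrite exprfctE.
by apply: is_derive_eq; rewrite /GRing.scale/=; ring.
Qed.

(** Two integrations by parts in one: G' = u'' v - u v'', where v'' = - 4 r^2 v and u'' = (n+2)(n+1)
    cos^n - (n+2)^2 cos^(n+2). [G] vanishes at 0 through the sines and at pi / 2 through the
    cosines. *)
Lemma wallis_rec r n :
  (n.+2 * n.+1)%:R * wallis r n = (n.+2%:R ^+ 2 - 4 * r ^+ 2) * wallis r n.+2.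
Proof.
(* [G = u' v - u v'] with [u = cos^(n+2)] and [v = cos (2 r t)]. *)
pose G t : R := - n.+2%:R * (cos t ^+ n.+1 * sin t * cos (2 * r * t))
  + 2 * r * (cos t ^+ n.+2 * sin (2 * r * t)).
pose k : R := n.+2%:R ^+ 2 - 4 * r ^+ 2.
pose g t : R := (n.+2 * n.+1)%:R * (cos t ^+ n * cos (2 * r * t))
  - k * (cos t ^+ n.+2 * cos (2 * r * t)).
have dG t : is_derive t 1 G (g t).
  have d1 := is_derive_cosX n t.
  have d2 := is_derive_cosX n.+1 t.
  have d3 := is_derive_cosM r t.
  have d4 := is_derive_sinM r t.
  have d5 := is_derive_sin t.
  rewrite /G /g /k; apply: is_derive_eq; rewrite /GRing.scale/=.
  have := sin2cos2 t; rewrite natrM -[n.+2%:R]natr1 -[n.+1%:R]natr1 !exprSr.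
  move: (cos t) (sin t) (cos _) (sin _) (cos t ^+ n) => c s c' s' cn hs.
  ring: hs.
have cg : continuous g.
  move=> t; apply: cvgB; (apply: cvgM; first exact: cvg_cst);
  exact: continuous_wallis.
have pi20 : 0 < pi / 2 :> R by rewrite divr_gt0// pi_gt0.
have := Rintegral_derive pi20 cg dG.
rewrite /G /g sin0 !mulr0 sin0 cos_pihalf !exprS !mul0r !mulr0 addr0 subr0.
have iw m := @continuous_itv_integrable R _ 0 (pi / 2) (@continuous_wallis r m).
have iwZ m (c : R) : mu.-integrable `[0, pi / 2]
    (EFin \o (fun t : R => c * (cos t ^+ m * cos (2 * r * t)))).
  apply: continuous_itv_integrable => t; apply: cvgM; first exact: cvg_cst.
  exact: continuous_wallis.
rewrite RintegralB//=.
rewrite !RintegralZl//=.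
by move=> /subr0_eq h; rewrite /wallis h /k; ring.
Qed.

Lemma wallis00 : wallis 0 0 = pi / 2.
Proof.
have pi20 : 0 < pi / 2 :> R by rewrite divr_gt0// pi_gt0.
have d (x : R) : is_derive x 1 (@id R) (cos x ^+ 0 * cos (2 * 0 * x)).
  by rewrite expr0 mul1r mulr0 mul0r cos0; exact: is_derive_id.
by have := Rintegral_derive pi20 (@continuous_wallis 0 0) d; rewrite subr0.
Qed.

Lemma wallisr0 r : r != 0 -> wallis r 0 = sin (r * pi) / (2 * r).
Proof.
move=> r0; have pi20 : 0 < pi / 2 :> R by rewrite divr_gt0// pi_gt0.
have r20 : 2 * r != 0 by rewrite mulf_neq0.
have d x : is_derive x 1 (fun t => (2 * r)^-1 * sin (2 * r * t))
    (cos x ^+ 0 * cos (2 * r * x)).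
  have h := is_derive_sinM r x.
  by apply: is_derive_eq; rewrite /GRing.scale/= expr0; field.
have := Rintegral_derive pi20 (@continuous_wallis r 0) d.
rewrite !mulr0 sin0 mulr0 subr0 => h.
by rewrite /wallis h mulrC; congr (sin _ / _); field.
Qed.

Lemma wallis0_gt0 n : 0 < wallis 0 n.*2.
Proof.
elim: n => [|n ih]; first by rewrite wallis00 divr_gt0// pi_gt0.
have := wallis_rec 0 n.*2; rewrite expr0n/= mulr0 subr0 => h.
rewrite -(@pmulr_rgt0 _ (n.*2.+2%:R ^+ 2)) ?exprn_gt0//.
by rewrite doubleS -h mulr_gt0// ltr0n muln_gt0.
Qed.

Lemma sin_le_id t : 0 <= t -> `|sin t| <= t.
Proof.
(* The Boolean [s] treats both signs at once: t - sin t and t + sin t vanish at 0 and are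
   non-decreasing because |cos| is at most 1. *)
move=> t0; have key (s : bool) : (-1) ^+ s * sin t <= t.
  rewrite -subr_ge0.
  pose f u : R := u - (-1) ^+ s * sin u.
  have df (u : R) : is_derive u 1 f (1 - (-1) ^+ s * cos u).
    by apply: is_derive_eq; rewrite /GRing.scale/=; ring.
  have cf : continuous f.
    move=> u; apply/differentiable_continuous/derivable1_diffP.
    by have [] := df u.
  have <- : f 0 = 0 by rewrite /f sin0 mulr0 subr0.
  apply: (@ger0_derive1_ndecr _ f 0 t) => //.
  - move=> u _; rewrite derive1E; have [_ ->] := df u.
    rewrite subr_ge0; have := cos_max u; rewrite ler_norml => /andP[c1 c2].
    by case: s {f df cf}; rewrite ?expr1 ?expr0 ?mulN1r ?mul1r// lerNl.
  - exact: continuous_subspaceT.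
have := key false; have := key true.
by rewrite expr1 expr0 mulN1r mul1r ler_norml lerNl => -> ->.
Qed.

(** The difference sin u - u cos u vanishes at 0 and has derivative u sin u, nonnegative on the
    interval. *)
Lemma mulr_cos_le_sin t : 0 <= t <= pi / 2 -> t * cos t <= sin t.
Proof.
move=> /andP[t0 t1]; rewrite -subr_ge0.
pose f u : R := sin u - u * cos u.
have df (u : R) : is_derive u 1 f (u * sin u).
  by apply: is_derive_eq; rewrite /GRing.scale/=; ring.
have cf : continuous f.
  move=> u; apply/differentiable_continuous/derivable1_diffP.
  by have [] := df u.
have <- : f 0 = 0 by rewrite /f sin0 mul0r subr0.
apply: (@ger0_derive1_ndecr _ f 0 t) => //.
- move=> u; rewrite in_itv/= => /andP[u0 ut]; rewrite derive1E.
  have [_ ->] := df u; apply: mulr_ge0; first exact: ltW.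
  apply: sin_ge0_pi; rewrite ltW//=.
  by rewrite (le_trans (ltW ut))// (le_trans t1)// ler_pdivrMr// ler_pMr ?pi_gt0// ler1n.
- exact: continuous_subspaceT.
Qed.

Let pi2_cos_ge0 t : t \in `[0, pi / 2] -> 0 <= cos t.
Proof.
rewrite in_itv/= => /andP[t0 t1]; apply: cos_ge0_pihalf.
by rewrite t1 andbT (le_trans _ t0)// oppr_le0 divr_ge0// pi_ge0.
Qed.

Let wallis_integrable r n : mu.-integrable `[0, pi / 2]
  (EFin \o (fun t : R => cos t ^+ n * cos (2 * r * t))).
Proof. apply: continuous_itv_integrable; exact: continuous_wallis. Qed.

Lemma wallis_le r n : wallis r n <= wallis 0 n.
Proof.
apply: le_Rintegral => //; [exact: wallis_integrable..|].
move=> t /pi2_cos_ge0 ct; rewrite mulr0 mul0r cos0 ler_wpM2l ?exprn_ge0//.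
Qed.

(* From [1 - cos (2 r t) <= 2 r^2 t^2] and [t cos t <= sin t]. *)
Lemma wallis0B_le r n :
  wallis 0 n.+2 - wallis r n.+2 <= 2 * r ^+ 2 * (wallis 0 n - wallis 0 n.+2).
Proof.
rewrite /wallis -!RintegralB//; [|exact: wallis_integrable..].
have cW s m := @continuous_wallis s m.
have cB s m s' m' : continuous (fun t : R => cos t ^+ m * cos (2 * s * t) -
    cos t ^+ m' * cos (2 * s' * t)).
  by move=> t; apply: cvgB; exact: cW.
rewrite -RintegralZl//; last exact: continuous_itv_integrable.
apply: le_Rintegral => //.
- exact: continuous_itv_integrable.
- apply: continuous_itv_integrable => t; apply: cvgM; first exact: cvg_cst.
  exact: cB.
move=> t tI; have ct := pi2_cos_ge0 tI.
move: tI; rewrite /= in_itv/= => tI; have /andP[t0 t1] := tI.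
rewrite mulr0 mul0r cos0 !mulr1.
have h1 : 1 - cos (2 * r * t) <= 2 * r ^+ 2 * t ^+ 2.
  rewrite (_ : 2 * r * t = (r * t) *+ 2); last by ring.
  rewrite cos_mulr2n cos2sin2.
  have : sin (r * t) ^+ 2 <= (r * t) ^+ 2.
    rewrite -[leLHS]real_normK ?num_real// -[leRHS]real_normK ?num_real//.
    rewrite ler_sqr ?nnegrE//.
    have [rt0|rt0] := leP 0 (r * t); first by rewrite (ger0_norm rt0) sin_le_id.
    by rewrite -normrN -sinN (ltr0_norm rt0) sin_le_id// oppr_ge0 ltW.
  by rewrite exprMn; lra.
have h2 : (t * cos t) ^+ 2 <= 1 - cos t ^+ 2.
  rewrite -sin2cos2 ler_sqr ?nnegrE ?mulr_ge0//; first exact: mulr_cos_le_sin.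
  by rewrite sin_ge0_pi// t0 (le_trans t1)// ler_pdivrMr// ler_pMr ?pi_gt0// ler1n.
rewrite !(exprSr (cos t)).
rewrite [leLHS](_ : _ = cos t ^+ n * (cos t ^+ 2 * (1 - cos (2 * r * t)))); last by ring.
rewrite [leRHS](_ : _ = cos t ^+ n * (2 * r ^+ 2 * (1 - cos t ^+ 2))); last by ring.
rewrite ler_wpM2l ?exprn_ge0//.
apply: (@le_trans _ _ (cos t ^+ 2 * (2 * r ^+ 2 * t ^+ 2))).
  by rewrite ler_wpM2l// sqr_ge0.
rewrite [leLHS](_ : _ = 2 * r ^+ 2 * (t * cos t) ^+ 2); last by ring.
by rewrite ler_wpM2l// mulr_ge0// sqr_ge0.
Qed.

(** The recurrence at r = 0 gives W(2n) - W(2n+2) = W(2n+2) / (2n+1) for W = [wallis 0]. So by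
    [wallis0B_le] the ratio at index 2n+2 differs from 1 by at most 2 r^2 / (2n+1), hence by at most
    2 r^2 / (n+1). *)
Lemma wallis_ratio_cvg r :
  wallis r n.*2 / wallis 0 n.*2 @[n --> \oo] --> (1 : R).
Proof.
rewrite -(cvg_shiftn 1) /=.
have lb n : 1 - 2 * r ^+ 2 / n.+1%:R <= wallis r (n + 1).*2 / wallis 0 (n + 1).*2 <= 1.
  rewrite addn1 doubleS; have W0 := wallis0_gt0 n.+1; rewrite doubleS in W0.
  rewrite ler_pdivlMr// ler_pdivrMr// mul1r wallis_le andbT.
  have := wallis0B_le r n.*2.
  have h := wallis_rec 0 n.*2; rewrite expr0n/= mulr0 subr0 in h.
  have -> : wallis 0 n.*2 - wallis 0 n.*2.+2 = wallis 0 n.*2.+2 / n.*2.+1%:R.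
    have n1 : n.*2.+1%:R != 0 :> R by rewrite pnatr_eq0.
    have n2 : n.*2.+2%:R != 0 :> R by rewrite pnatr_eq0.
    have -> : wallis 0 n.*2 = n.*2.+2%:R / n.*2.+1%:R * wallis 0 n.*2.+2.
      apply: (mulfI n1); apply: (mulfI n2); rewrite [LHS]mulrA -natrM h.
      by field.
    by rewrite -[n.*2.+2%:R]natr1; field.
  move=> h3; rewrite mulrBl mul1r lerBlDr -lerBlDl; apply: le_trans h3 _.
  rewrite mulrA [leRHS]mulrAC ler_wpM2l//.
    by apply: mulr_ge0; [rewrite mulr_ge0// sqr_ge0|exact: ltW].
  by rewrite lef_pV2 ?posrE// ler_nat ltnS -addnn leq_addr.
apply: (@squeeze_cvgr _ _ _ _ (fun n => 1 - 2 * r ^+ 2 / n.+1%:R) (fun=> 1)).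
- exact: nearW.
- rewrite -[X in _ --> X]subr0; apply: cvgB; first exact: cvg_cst.
  rewrite -[X in _ --> X](mulr0 (2 * r ^+ 2)); apply: cvgM; first exact: cvg_cst.
  exact: cvg_harmonic.
- exact: cvg_cst.
Qed.

(** Dividing the recurrence at r by the one at 0 shows that the ratio at 2n is the ratio at 2n+2
    times 1 - r^2 / (n+1)^2, so the left-hand side does not depend on n. *)
Lemma wallis_ratioE r n : (forall j : nat, r ^+ 2 != j.+1%:R ^+ 2) ->
  wallis r n.*2 / wallis 0 n.*2 * \prod_(0 <= j < n) (1 - (r / j.+1%:R) ^+ 2) =
  wallis r 0 / wallis 0 0.
Proof.
move=> rj; elim: n => [|n ih]; first by rewrite big_geq// mulr1.
rewrite big_nat_recr//= -ih doubleS.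
have W0 := wallis0_gt0 n; have W0S := wallis0_gt0 n.+1; rewrite doubleS in W0S.
have h0 := wallis_rec 0 n.*2; rewrite expr0n/= mulr0 subr0 in h0.
have hr := wallis_rec r n.*2.
have n1 : n.*2.+1%:R != 0 :> R by rewrite pnatr_eq0.
have n2 : n.+1%:R != 0 :> R by rewrite pnatr_eq0.
have e2 : n.*2.+2%:R = 2 * n.+1%:R :> R by rewrite -doubleS -mul2n natrM.
rewrite natrM e2 in h0 hr.
move: (\prod_(_ <= _ < _) _) => P.
move: (n.*2.+1%:R : R) (n.+1%:R : R) (wallis 0 n.*2) (wallis r n.*2)
  (wallis 0 n.*2.+2) (wallis r n.*2.+2) n1 n2 W0 W0S h0 hr.
move=> A B u v u' v' A0 B0 u0 u0' h0 hr.
have AB : 2 * B * A != 0 by rewrite !mulf_neq0.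
have -> : v = (B ^+ 2 - r ^+ 2) * 4 / (2 * B * A) * v'.
  by apply: (mulfI AB); rewrite hr; field; rewrite B0 A0.
have -> : u = 2 * B / A * u'.
  by apply: (mulfI AB); rewrite h0; field.
by field; rewrite B0 A0 gt_eqF.
Qed.

(** Euler's product on []0, 1[]: the partial product is the initial ratio, which is sin (r pi) / (r
    pi), divided by a ratio tending to 1. *)
Lemma sin_prod_cvg r : 0 < r < 1 ->
  \prod_(0 <= j < n) (1 - (r / j.+1%:R) ^+ 2) @[n --> \oo]
    --> sin (r * pi) / (r * pi).
Proof.
move=> /andP[r0 r1].
have rj j : r ^+ 2 != j.+1%:R ^+ 2.
  rewrite lt_eqF// ltr_pXn2r ?nnegrE// ?(ltW r0)//.
  by rewrite (lt_le_trans r1)// ler1n.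
have q0 : sin (r * pi) / (r * pi) = wallis r 0 / wallis 0 0.
  rewrite wallisr0 ?gt_eqF// wallis00.
  move: (@pi R) (sin _) (lt0r_neq0 (pi_gt0 R)) => p s p0.
  by field; rewrite p0 lt0r_neq0.
have sp : 0 < sin (r * pi).
  by rewrite sin_gt0_pi// mulr_gt0 ?pi_gt0//= gtr_pMl ?pi_gt0.
have h n : \prod_(0 <= j < n) (1 - (r / j.+1%:R) ^+ 2) =
    sin (r * pi) / (r * pi) / (wallis r n.*2 / wallis 0 n.*2).
  rewrite q0 -(wallis_ratioE n rj) mulrAC divff ?mul1r//.
  have : sin (r * pi) / (r * pi) != 0.
    by rewrite mulf_neq0 ?invr_eq0 ?mulf_neq0 ?gt_eqF ?pi_gt0.
  rewrite q0 -(wallis_ratioE n rj); apply: contra => /eqP ->.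
  by rewrite mul0r.
rewrite -[X in _ --> X]divr1 (eq_cvg _ _ h).
apply: cvgM; first exact: cvg_cst.
by apply: cvgV => //; exact: wallis_ratio_cvg.
Qed.

End wallis.

(** * The reflection formula *)

(** For p = 1 the factors k + r - i, read in reverse order, are r + 1, ..., r + k - 1. Hence A_k(1,
    r) is the rising factorial r (r + 1) ... (r + k - 1) over k!. *)
Lemma fuss_catalan_numberS (R : realType) (r : R) (k : nat) :
  fuss_catalan_number 1 r k.+1 =
  (r + k%:R) / k.+1%:R * fuss_catalan_number 1 r k.
Proof.
have E m : fuss_catalan_number 1 r m = \prod_(0 <= i < m) (r + i%:R) / m`!%:R.
  case: m => [|m]; first by rewrite /fuss_catalan_number/= big_geq// divr1.
  rewrite /fuss_catalan_number/= [in RHS]big_ltn// addr0 mulrAC; congr (_ * _ / _).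
  rewrite big_nat_rev/= big_nat [RHS]big_nat; apply: eq_bigr => i /andP[i0 im].
  rewrite mulr1 add1n subSS natrB; last exact: ltnW.
  by ring.
rewrite !E big_nat_recr//= factS natrM.
by field; rewrite nat1r !pnatr_eq0 -lt0n fact_gt0.
Qed.

(** Weighted AM-GM, as Young's inequality for the conjugate exponents 1/r and 1/(1 - r) applied to
    x^r and y^(1 - r). *)
Lemma powR_young (R : realType) (r x y : R) : 0 < r < 1 -> 0 < x -> 0 < y ->
  x `^ r * y `^ (1 - r) <= r * x + (1 - r) * y.
Proof.
move=> /andP[r0 r1] x0 y0; have r10 : 0 < 1 - r by rewrite subr_gt0.
have := @conjugate_powR R (x `^ r) (y `^ (1 - r)) r^-1 (1 - r)^-1.
have powK (u s : R) : 0 < u -> 0 < s -> (u `^ s) `^ s^-1 = u.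
  by move=> u0 s0; rewrite -powRrM divff ?lt0r_neq0// powRr1// ltW.
rewrite !powK// !invrK => h.
rewrite [r * x]mulrC [_ * y]mulrC; apply: h; rewrite ?powR_ge0 ?invr_gt0//.
by rewrite addrC subrK.
Qed.

Section reflection.
Context {R : realType}.
Implicit Types (a b r x : R) (n : nat).

(** Isolates the dependence on r in the factor x^r (1 - x)^(1 - r), which the next bounds compare
    with polynomials. *)
Lemma beta_kernel_shift r a x : 0 < x < 1 ->
  beta_kernel (a + r) (a + 1 - r) x =
  beta_kernel a a x * (x `^ r * (1 - x) `^ (1 - r)).
Proof.
move=> /andP[x0 x1]; have y0 : 0 < 1 - x by rewrite subr_gt0.
rewrite /beta_kernel mulrACA -!powRD ?(gt_eqF x0) ?(gt_eqF y0) ?implybT//.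
by congr (_ `^ _ * _ `^ _); ring.
Qed.

Lemma beta_integralSS a b : 0 < a -> 0 < b ->
  beta_integral (a + 1) (b + 1) =
  a * b / ((a + b) * (a + b + 1)) * beta_integral a b.
Proof.
move=> a0 b0; rewrite beta_integralSl ?addr_gt0// beta_integralSr//.
by field; apply/andP; split; apply: lt0r_neq0; lra.
Qed.

(** AM-GM bounds x^r (1 - x)^(1 - r) by r x + (1 - r) (1 - x). Since B(a + 1, a) and B(a, a + 1) are
    both half of B(a, a), the weights r and 1 - r disappear. *)
Lemma beta_integral_diag_le r a : 0 < r < 1 -> 0 < a ->
  beta_integral (a + r) (a + 1 - r) <= beta_integral a a / 2.
Proof.
move=> r01 a0; have /andP[r0 r1] := r01.
have -> : beta_integral a a / 2 = r * beta_integral (a + 1) a +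
    (1 - r) * beta_integral a (a + 1).
  rewrite beta_integralSl// beta_integralSr//; field.
  by rewrite gt_eqF// addr_gt0.
have i1 := @integrable_beta_kernel R (a + 1) a (addr_gt0 a0 ltr01) a0.
have i2 := @integrable_beta_kernel R a (a + 1) a0 (addr_gt0 a0 ltr01).
rewrite /beta_integral -!RintegralZl//= -RintegralD//=; last 2 first.
  exact: (integrableZl _ r i1).
  exact: (integrableZl _ (1 - r) i2).
apply: le_Rintegral => //.
- by apply: integrable_beta_kernel; lra.
- exact: (integrableD _ (integrableZl _ r i1) (integrableZl _ (1 - r) i2)).
move=> x; rewrite /= in_itv/= => x01; have /andP[x0 x1] := x01.
rewrite beta_kernel_shift// beta_kernelSl// beta_kernelSr//.
rewrite !(mulrCA _ (beta_kernel a a x)) -mulrDr ler_wpM2l ?beta_kernel_ge0//.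
by apply: powR_young; rewrite ?subr_gt0.
Qed.

Lemma beta_integral_diag_ge r a : 0 < r < 1 -> 0 < a ->
  a / (2 * a + 1) * beta_integral a a <= beta_integral (a + r) (a + 1 - r).
Proof.
move=> r01 a0; have /andP[r0 r1] := r01.
have aS : 0 < a + 1 by rewrite addr_gt0.
(* The polynomial minorant of x^r (1 - x)^(1 - r) is 4 x (1 - x) (r x + (1 - r) (1 - x)). Both
   shifted integrals are half of B(a + 1, a + 1) = a / (2 (2a + 1)) B(a, a), and the weights add up
   to 4. *)
have -> : a / (2 * a + 1) * beta_integral a a =
    (4 * r) * beta_integral (a + 1 + 1) (a + 1) +
    (4 * (1 - r)) * beta_integral (a + 1) (a + 1 + 1).
  rewrite (beta_integralSl aS aS) (beta_integralSr aS aS) beta_integralSS//.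
  move: (beta_integral a a) => B.
  by field; apply/and3P; split; apply: lt0r_neq0; lra.
have i1 := @integrable_beta_kernel R (a + 1 + 1) (a + 1) (addr_gt0 aS ltr01) aS.
have i2 := @integrable_beta_kernel R (a + 1) (a + 1 + 1) aS (addr_gt0 aS ltr01).
rewrite /beta_integral -!RintegralZl//= -RintegralD//=; last 2 first.
  exact: (integrableZl _ (4 * r) i1).
  exact: (integrableZl _ (4 * (1 - r)) i2).
apply: le_Rintegral => //.
- exact: (integrableD _ (integrableZl _ (4 * r) i1)
    (integrableZl _ (4 * (1 - r)) i2)).
- by apply: integrable_beta_kernel; lra.
move=> x; rewrite /= in_itv/= => x01; have /andP[x0 x1] := x01.
rewrite beta_kernel_shift// !(beta_kernelSl, beta_kernelSr)//.
have y0 : 0 < 1 - x by rewrite subr_gt0.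
rewrite [leLHS](_ : _ = beta_kernel a a x *
  (4 * (x * (1 - x)) * (r * x + (1 - r) * (1 - x)))); last by ring.
rewrite ler_wpM2l ?beta_kernel_ge0//.
(* [P Q = x (1 - x)], [r x + (1 - r) (1 - x) <= 1 - Q] and [4 Q (1 - Q) <= 1]. *)
have P0 : 0 < x `^ r * (1 - x) `^ (1 - r) by rewrite mulr_gt0// powR_gt0.
have Q0 : 0 < x `^ (1 - r) * (1 - x) `^ r by rewrite mulr_gt0// powR_gt0.
have PQ : x * (1 - x) = (x `^ r * (1 - x) `^ (1 - r)) * (x `^ (1 - r) * (1 - x) `^ r).
  have pow1 (y : R) : 0 < y -> y `^ r * y `^ (1 - r) = y.
    move=> h; rewrite -powRD; last by rewrite (gt_eqF h) implybT.
    by rewrite (addrC r) subrK powRr1// ltW.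
  by rewrite mulrACA pow1// [(1 - x) `^ _ * _]mulrC pow1.
have Qle : x `^ (1 - r) * (1 - x) `^ r <= (1 - r) * x + r * (1 - x).
  have := @powR_young R (1 - r) x (1 - x); rewrite subKr.
  by apply; rewrite ?subr_gt0 ?r1 ?gtrBl.
move: P0 Q0 PQ Qle; move: (x `^ r * _) (x `^ (1 - r) * _) => P Q P0 Q0 -> Qle.
rewrite mulrCA -[leRHS]mulr1 -mulrA ler_pM2l//.
have : Q * (r * x + (1 - r) * (1 - x)) <= Q * (1 - Q).
  by rewrite ler_pM2l//; lra.
have := sqr_ge0 (2 * Q - 1); rewrite expr2; lra.
Qed.

Lemma beta_integral_diag_gt0 n : 0 < beta_integral n.+1%:R n.+1%:R :> R.
Proof.
elim: n => [|n ih]; first by rewrite beta_integral11.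
by rewrite -natr1 beta_integralSS// mulr_gt0// divr_gt0 ?mulr_gt0 ?addr_gt0.
Qed.

(** Normalised so that, with a = n + 1, the two diagonal bounds confine it between 2a / (2a + 1) and
    1. *)
Let D r n := beta_integral (n.+1%:R + r) (n.+1%:R + 1 - r) * 2
  / beta_integral n.+1%:R n.+1%:R.

Let D_cvg r : 0 < r < 1 -> D r n @[n --> \oo] --> (1 : R).
Proof.
move=> r01.
have lb n : 1 - n.+1%:R^-1 <= D r n <= 1.
  have c0 := beta_integral_diag_gt0 n.
  have n0 : 0 < n.+1%:R :> R by [].
  apply/andP; split; rewrite /D; last first.
    by rewrite ler_pdivrMr// mul1r -ler_pdivlMr// beta_integral_diag_le.
  have h := beta_integral_diag_ge r01 n0.
  have k : 1 - n.+1%:R^-1 <= 2 * (n.+1%:R / (2 * n.+1%:R + 1)) :> R.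
    move: (n.+1%:R : R) n0 => a a0.
    have a1 : a * a^-1 = 1 by rewrite divff ?lt0r_neq0.
    rewrite mulrA ler_pdivlMr; last by lra.
    rewrite -(ler_pM2r a0) mulrAC mulrBl mulVf ?lt0r_neq0// mul1r.
    nra.
  rewrite ler_pdivlMr//; apply: (@le_trans _ _
    (2 * (n.+1%:R / (2 * n.+1%:R + 1)) * beta_integral n.+1%:R n.+1%:R)).
    by rewrite ler_pM2r.
  by rewrite -mulrA mulrC ler_pM2r.
apply: (@squeeze_cvgr _ _ _ _ (fun n => 1 - n.+1%:R^-1) (fun=> 1)).
- exact: nearW.
- rewrite -[X in _ --> X]subr0; apply: cvgB; first exact: cvg_cst.
  exact: cvg_harmonic.
- exact: cvg_cst.
Qed.

(** With a = n + 1, passing to n + 1 multiplies [D] by (a + r)(a + 1 - r) / (a (a + 1)). The factor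
    1 + r / a compensates for the asymmetric shifts and turns this into 1 - r^2 / (a + 1)^2. *)
Let DE r n : 0 < r < 1 -> D r n * (1 + r / n.+1%:R) =
  r * beta_integral r (1 - r) * \prod_(0 <= j < n.+1) (1 - (r / j.+1%:R) ^+ 2).
Proof.
move=> /andP[r0 r1]; have r10 : 0 < 1 - r by rewrite subr_gt0.
elim: n => [|n ih].
  rewrite big_nat1 /D beta_integral11 !divr1 [1 + r]addrC addrAC beta_integralSS//.
  rewrite (_ : r + (1 - r) = 1); last by ring.
  move: (beta_integral r _) => B. by field.
rewrite big_nat_recr//= mulrA -ih /D.
have -> : n.+2%:R = n.+1%:R + 1 :> R by rewrite natr1.
have n0 : 0 < n.+1%:R :> R by [].
have c0 := beta_integral_diag_gt0 n.
move: (n.+1%:R : R) n0 c0 => a a0 c0.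
rewrite addrAC [a + 1 + 1 - r]addrAC !beta_integralSS//; [|lra..].
move: (beta_integral a a) (beta_integral (a + r) _) c0 => B C B0.
by field; repeat (apply/andP; split); apply: lt0r_neq0; lra.
Qed.

(** The sequence in [DE] has limit 1 by squeezing and limit B(r, 1 - r) sin (r pi) / pi by Euler's
    product. *)
Lemma beta_integral_reflection r : 0 < r < 1 ->
  beta_integral r (1 - r) = pi / sin (r * pi).
Proof.
move=> r01; have /andP[r0 r1] := r01.
have p0 := pi_gt0 R.
have sp : 0 < sin (r * pi).
  by rewrite sin_gt0_pi// mulr_gt0//= gtr_pMl.
have L : D r n * (1 + r / n.+1%:R) @[n --> \oo] --> (1 * (1 + r * 0) : R).
  apply: cvgM; first exact: D_cvg.
  apply: cvgD; first exact: cvg_cst.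
  by apply: cvgM; [exact: cvg_cst|exact: cvg_harmonic].
have L' : D r n * (1 + r / n.+1%:R) @[n --> \oo] -->
    r * beta_integral r (1 - r) * (sin (r * pi) / (r * pi)).
  rewrite (eq_cvg _ _ (fun n => DE n r01)).
  apply: cvgM; first exact: cvg_cst.
  have := sin_prod_cvg r01; rewrite -(cvg_shiftn 1).
  by under eq_fun do rewrite addn1.
have := cvg_unique _ L L'; rewrite mulr0 addr0 mulr1 => h.
have sp0 : sin (r * pi) / pi != 0 by rewrite mulf_neq0 ?invr_eq0 ?lt0r_neq0.
apply: (mulfI sp0).
rewrite [RHS](_ : _ = 1); last first.
  by rewrite mulf_div [pi * _]mulrC divff// mulf_neq0 ?lt0r_neq0.
rewrite [RHS]h//; move: (@pi R) (sin _) (beta_integral _ _) p0 => p s B p0'.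
by field; rewrite !lt0r_neq0.
Qed.

End reflection.

(** * Determinacy of moments on [-1, 1] *)

Section step_polynomial.
Context {R : realType}.
Implicit Types (a t x y : R) (n : nat).

Lemma bernoulli_ineq y n : - 1 <= y -> 1 + n%:R * y <= (1 + y) ^+ n.
Proof.
move=> y1; elim: n => [|n ih]; first by rewrite mul0r addr0 expr0.
rewrite exprS; apply: (@le_trans _ _ ((1 + y) * (1 + n%:R * y))).
  rewrite -natr1; have : 0 <= n%:R * y ^+ 2 by rewrite mulr_ge0// sqr_ge0.
  by rewrite expr2; lra.
by rewrite ler_wpM2l//; lra.
Qed.

Lemma cvg_natM_expr t : 0 <= t < 1 -> n%:R * t ^+ n @[n --> \oo] --> (0 : R).
Proof.
move=> /andP[t0 t1]; pose s := Num.sqrt t.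
(* Write n t^n = (n s^n) s^n. The bound [b] on the first factor reflects that each of the n terms of
   1 + s + ... + s^(n-1) is at least s^n. *)
have s0 : 0 <= s by exact: sqrtr_ge0.
have s1 : s < 1 by rewrite -sqrtr1 ltr_sqrt.
have p : 0 < 1 - s by rewrite subr_gt0.
have b n : n%:R * s ^+ n * (1 - s) <= 1 - s ^+ n.
  elim: n => [|n ih]; first by rewrite !mul0r expr0 subrr.
  have sn0 : 0 <= s ^+ n by rewrite exprn_ge0.
  have sn1 : s ^+ n.+1 <= 1 by rewrite exprn_ile1// ltW.
  rewrite exprS in sn1 *; rewrite -natr1.
  move: (s ^+ n) (n%:R : R) sn0 sn1 ih => v N _ sn1 ih.
  have A := ler_wpM2l s0 ih; have B := ler_wpM2l (ltW p) sn1.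
  lra.
apply: (@squeeze_cvgr _ _ _ _ (fun=> 0) (fun n => (1 - s)^-1 * s ^+ n)).
- apply: nearW => n; rewrite mulr_ge0 ?exprn_ge0//=.
  rewrite -{1}(sqr_sqrtr t0) -/s expr2 exprMn mulrA ler_wpM2r ?exprn_ge0//.
  by rewrite -(ler_pM2r p) mulVf ?lt0r_neq0// (le_trans (b n))// gerBl exprn_ge0.
- exact: cvg_cst.
- rewrite -[X in _ --> X](mulr0 (1 - s)^-1); apply: cvgM; first exact: cvg_cst.
  by apply: cvg_expr; rewrite ger0_norm.
Qed.

(* The exponent [n * 2 ^ n] makes [N t ^ n] tend to [0] for [t < 1/2] and to
   infinity for [1/2 <= t]. *)
Lemma cvg_step t : 0 <= t <= 1 ->
  (1 - t ^+ n) ^+ (n * 2 ^ n) @[n --> \oo] --> ((t < 2^-1)%R%:R : R).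
Proof.
move=> /andP[t0 t1].
have tn n : 0 <= t ^+ n <= 1 by rewrite exprn_ge0// exprn_ile1.
case: ltP => t2.
  (* Bernoulli's inequality gives the lower bound, as n 2^n t^n = n (2 t)^n. *)
  apply: (@squeeze_cvgr _ _ _ _ (fun n => 1 - n%:R * (2 * t) ^+ n) (fun=> 1)).
  - apply: nearW => n; have /andP[tn0 tn1] := tn n; apply/andP; split; last first.
      by rewrite exprn_ile1//; lra.
    have := @bernoulli_ineq (- t ^+ n) (n * 2 ^ n); rewrite mulrN natrM natrX.
    by rewrite exprMn mulrA; apply; lra.
  - rewrite -[X in _ --> X]subr0; apply: cvgB; first exact: cvg_cst.
    by apply: cvg_natM_expr; lra.
  - exact: cvg_cst.
apply: (@squeeze_cvgr _ _ _ _ (fun=> 0) (fun n => n.+1%:R^-1)).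
- apply: nearW => n; have /andP[tn0 tn1] := tn n; apply/andP; split.
    by rewrite exprn_ge0//; lra.
  (* With N = n 2^n, it suffices to bound (1 - y)^N for y = 2^-n, where N y = n: Bernoulli gives (1
     + y)^N >= 1 + n, while (1 - y)^N (1 + y)^N <= 1. *)
  pose y : R := 2^-1 ^+ n.
  have y0 : 0 <= y by rewrite exprn_ge0.
  have y1 : y <= 1 by rewrite exprn_ile1// invf_le1// ler1n.
  have yt : y <= t ^+ n by rewrite lerXn2r// nnegrE.
  have ny : (n * 2 ^ n)%:R * y = n%:R.
    by rewrite natrM natrX -mulrA -exprMn divff// expr1n mulr1.
  rewrite -[leRHS]mul1r ler_pdivlMr//.
  apply: (@le_trans _ _ ((1 - y) ^+ (n * 2 ^ n) * (1 + y) ^+ (n * 2 ^ n))).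
    apply: ler_pM => //; first by rewrite exprn_ge0//; lra.
      by rewrite lerXn2r ?nnegrE//; lra.
    by rewrite -nat1r -[X in _ + X]ny bernoulli_ineq//; lra.
  by rewrite -exprMn exprn_ile1//; nra.
- exact: cvg_cst.
- exact: cvg_harmonic.
Qed.

(** The polynomial of [cvg_step] composed with an affine map that sends a to 1/2 and [-1, 1] into
    [0, 1], since |x - a| <= |a| + 1 there. *)
Definition step_poly a n : {poly R} :=
  (1 - ((2 * (`|a| + 1))^-1 *: 'X + (2^-1 - a / (2 * (`|a| + 1)))%:P) ^+ n)
    ^+ (n * 2 ^ n).

Let step_arg a x := 2^-1 + (x - a) / (2 * (`|a| + 1)).

Let step_argP a x : `|x| <= 1 -> 0 <= step_arg a x <= 1.
Proof.
move=> x1; have d0 : 0 < 2 * (`|a| + 1) by have := normr_ge0 a; lra.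
have : `|(x - a) / (2 * (`|a| + 1))| <= 2^-1.
  rewrite normrM normfV (gtr0_norm d0) ler_pdivrMr// mulKf//.
  by rewrite (le_trans (ler_normB _ _))//; lra.
by rewrite ler_norml /step_arg; lra.
Qed.

Let horner_step_poly a n x :
  (step_poly a n).[x] = (1 - step_arg a x ^+ n) ^+ (n * 2 ^ n).
Proof.
rewrite /step_poly !(hornerE, horner_exp)/=.
by rewrite [X in 1 - X ^+ _](_ : _ = step_arg a x)// /step_arg; ring.
Qed.

Lemma cvg_step_poly a x : `|x| <= 1 ->
  (step_poly a n).[x] @[n --> \oo] --> ((x < a)%R%:R : R).
Proof.
move=> x1; have := cvg_step (step_argP a x1).
rewrite (_ : (step_arg a x < 2^-1) = (x < a)); last first.
  have d0 : 0 < 2 * (`|a| + 1) by have := normr_ge0 a; lra.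
  by rewrite /step_arg gtrDl pmulr_llt0 ?invr_gt0// subr_lt0.
by apply: cvg_trans; under eq_fun do rewrite horner_step_poly.
Qed.

Lemma norm_step_poly_le1 a n x : `|x| <= 1 -> `|(step_poly a n).[x]| <= 1.
Proof.
move=> /(step_argP a)/andP[s0 s1]; rewrite horner_step_poly normrX exprn_ile1//.
have := exprn_ge0 n s0; have := exprn_ile1 n s0 s1.
by rewrite ler_norml; lra.
Qed.

End step_polynomial.

Section moments.
Context {R : realType}.

Section density.
Variables (m : {measure set (measurableTypeR R) -> \bar R}) (h : R -> R).
Hypothesis ih : forall k, m.-integrable setT (fun x => (x ^+ k * h x)%:E).

Lemma integrable_horner (p : {poly R}) :
  m.-integrable setT (fun x => (p.[x] * h x)%:E).
Proof.
rewrite (_ : (fun x => _) =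
    (fun x => \sum_(i < size p) ((p`_i)%:E * (x ^+ i * h x)%:E)))%E; last first.
  apply/funext => x; rewrite sumEFin horner_coef mulr_suml; congr EFin.
  by apply: eq_bigr => i _; rewrite mulrA.
by apply: integrable_sum => // i _; exact: integrableZl.
Qed.

Lemma Rintegral_horner (p : {poly R}) :
  \int[m]_x (p.[x] * h x) =
  \sum_(i < size p) p`_i * \int[m]_x (x ^+ i * h x).
Proof.
apply: EFin_inj; rewrite /Rintegral fineK; last first.
  exact/integrable_fin_num/integrable_horner.
rewrite -sumEFin.
transitivity (\int[m]_x \sum_(i < size p) ((p`_i)%:E * (x ^+ i * h x)%:E))%E.
  apply: eq_integral => x _; rewrite sumEFin horner_coef mulr_suml; congr EFin.
  by apply: eq_bigr => i _; rewrite mulrA.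
rewrite integral_sum//; last by move=> i; exact: integrableZl.
apply: eq_bigr => i _; rewrite integralZl// EFinM fineK//.
exact/integrable_fin_num.
Qed.

Hypothesis hsupp : {ae m, forall x, h x != 0 -> `|x| <= 1}.

(** Dominated convergence with bound |h|: on [-1, 1] the polynomials are bounded by 1, and elsewhere
    [h] vanishes almost everywhere. *)
Lemma cvg_Rintegral_step_poly (a : R) :
  \int[m]_x ((step_poly a n).[x] * h x) @[n --> \oo] -->
  \int[m]_(x in `]-oo, a[) h x.
Proof.
have ih0 : m.-integrable setT (EFin \o h).
  by have := ih 0; congr (_.-integrable _ _); apply/funext => x /=; rewrite mul1r.
have mh : measurable_fun setT h.
  by apply/measurable_EFinP; exact: (measurable_int _ ih0).
have ih' : m.-integrable `]-oo, a[ (EFin \o h).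
  by apply: integrableS ih0.
have Hcvg : {ae m, forall x, setT x -> (((step_poly a n).[x] * h x)%:E
    @[n --> \oo] --> ((EFin \o h) \_ `]-oo, a[) x)}.
  apply: (@filterS _ _ (ae_filter_ringOfSetsType m) _ _ _ hsupp) => x hx _.
  rewrite patchE.
  (* Outside [-1, 1] the polynomials may diverge, but there the product with [h x = 0] is constantly
     0. *)
  have [hx0|hx0] := eqVneq (h x) 0.
    rewrite (_ : (fun n => _) = fun=> 0%:E); last first.
      by apply/funext => n; rewrite hx0 mulr0.
    by case: ifP => _; rewrite /= ?hx0; exact: cvg_cst.
  rewrite -(_ : ((x < a)%R%:R * h x)%:E =
      if x \in `]-oo, a[%classic then (EFin \o h) x else 0%E).
    apply: cvg_EFin; first exact: nearW.
    by apply: cvgM; [apply: cvg_step_poly; exact: hx|exact: cvg_cst].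
  by rewrite mem_setE in_itv/=; case: (x < a); rewrite ?mul1r ?mul0r.
have Hle : {ae m, forall x n, setT x ->
    (`|((step_poly a n).[x] * h x)%:E| <= `|(EFin \o h) x|)%E}.
  apply: (@filterS _ _ (ae_filter_ringOfSetsType m) _ _ _ hsupp) => x hx n _.
  rewrite /= lee_fin normrM.
  have [->|hx0] := eqVneq (h x) 0; first by rewrite normr0 mulr0.
  by rewrite ler_piMl// norm_step_poly_le1// hx.
have mlim : measurable_fun setT ((EFin \o h) \_ `]-oo, a[).
  apply/(measurable_restrictT _ (measurable_itv _)).
  exact: (measurable_int _ ih').
have [_ _] := dominated_convergence measurableT
  (fun n => measurable_int _ (integrable_horner (step_poly a n))) mlim
  Hcvg (integrable_abse ih0) Hle.
rewrite -integral_mkcond => cvg.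
rewrite /Rintegral; apply: fine_cvg; rewrite fineK//.
exact: integrable_fin_num.
Qed.

End density.

(** The weights let one statement compare [mu] itself, with weight 1, and Lebesgue measure with
    weight [W1 r]. Equal moments give equal integrals of each step polynomial, hence equal
    limits. *)
Lemma moments_determine_cdf (m1 m2 : {measure set (measurableTypeR R) -> \bar R})
    (h1 h2 : R -> R) (a : R) :
  (forall k, m1.-integrable setT (fun x => (x ^+ k * h1 x)%:E)) ->
  (forall k, m2.-integrable setT (fun x => (x ^+ k * h2 x)%:E)) ->
  {ae m1, forall x, h1 x != 0 -> `|x| <= 1} ->
  {ae m2, forall x, h2 x != 0 -> `|x| <= 1} ->
  (forall k, \int[m1]_x (x ^+ k * h1 x) = \int[m2]_x (x ^+ k * h2 x)) ->
  \int[m1]_(x in `]-oo, a[) h1 x = \int[m2]_(x in `]-oo, a[) h2 x.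
Proof.
move=> ih1 ih2 s1 s2 mE.
have c1 := @cvg_Rintegral_step_poly m1 h1 ih1 s1 a.
have c2 := @cvg_Rintegral_step_poly m2 h2 ih2 s2 a.
suff E : (fun n => \int[m1]_x ((step_poly a n).[x] * h1 x)) =
    (fun n => \int[m2]_x ((step_poly a n).[x] * h2 x)).
  by rewrite E in c1; exact: (cvg_unique _ c1 c2).
apply/funext => n; rewrite !Rintegral_horner//.
by apply: eq_bigr => i _; rewrite mE.
Qed.

End moments.

(** * The density of mu(1, r) *)

(* Unlike [ge0_le_integral], no measurability is required. *)
Lemma ge0_le_integral_nonmeasurable d (T : measurableType d) (R : realType)
    (mu : {measure set T -> \bar R}) (D : set T) (f g : T -> \bar R) :
  (forall x, D x -> (0 <= f x)%E) -> (forall x, D x -> (f x <= g x)%E) ->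
  (\int[mu]_(x in D) f x <= \int[mu]_(x in D) g x)%E.
Proof.
move=> f0 fg; rewrite !ge0_integralE//; last first.
  by move=> x Dx; apply: le_trans (fg x Dx); exact: f0.
apply: le_ereal_sup => _ [h /= hf <-]; exists h => // x.
by apply: le_trans (hf x) _; exact: lee_restrict.
Qed.

Section density_measure.
Context {R : realType}.
Variable f : R -> R.
Hypotheses (mf : measurable_fun setT f) (f0 : forall x, 0 <= f x).

(* The hypotheses are arguments so that the measure structure is inferred. *)
Definition density_measure of measurable_fun setT f & (forall x, 0 <= f x) :=
  fun A : set (measurableTypeR R) =>
    (\int[lebesgue_measure]_(x in A) (f x)%:E)%E.

Local Notation nu := (density_measure mf f0).

Let nu0 : nu set0 = 0%E.
Proof. exact: integral_set0. Qed.

Let nu_ge0 A : (0 <= nu A)%E.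
Proof. by apply: integral_ge0 => x _; rewrite lee_fin. Qed.

Let nu_sigma_additive : semi_sigma_additive nu.
Proof.
move=> F mF tF _; rewrite /density_measure ge0_integral_bigcup//; last 2 first.
- by apply/measurable_EFinP; exact: measurable_funTS.
- by move=> x _; rewrite lee_fin.
by apply: is_cvg_nneseries => n _ _; exact: nu_ge0.
Qed.

HB.instance Definition _ := isMeasure.Build _ _ _ nu
  nu0 nu_ge0 nu_sigma_additive.

End density_measure.

(** The open left rays are stable under intersection and generate the Borel sets, and those ending
    at the naturals have finite measure and cover the line. *)
Lemma measure_eq_itvNyo (R : realType)
    (m1 m2 : {measure set (measurableTypeR R) -> \bar R}) :
  (forall a : R, m1 `]-oo, a[%classic = m2 `]-oo, a[%classic) ->
  (forall a : R, (m1 `]-oo, a[%classic < +oo)%E) ->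
  forall A : set (measurableTypeR R), measurable A -> m1 A = m2 A.
Proof.
move=> m12 m1oo A mA.
apply: (@measure_unique _ R (measurableTypeR R) (@RGenInftyO.G R)
  (fun k => `]-oo, k%:R[%classic) _ _ _ _ m1 m2) => //.
- exact: RGenInftyO.measurableE.
- move=> _ _ [a ->] [b ->]; exists (Num.min a b).
  apply/seteqP; split=> x /=; rewrite !in_itv/= lt_min; first by case=> -> ->.
  by move/andP.
- by move=> k; exists k%:R.
- rewrite eqEsubset; split=> // x _; exists (Num.bound `|x|) => //=.
  by rewrite in_itv/= (le_lt_trans (ler_norm x))// archi_boundP.
- by move=> _ [a ->].
Qed.

Section fuss_catalan.
Context {R : realType} (r : R).
Hypotheses (hr0 : 0 < r) (hr1 : r < 1).

Let hr : 0 < r < 1. Proof. by rewrite hr0 hr1. Qed.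

Let hr10 : 0 < 1 - r. Proof. by rewrite subr_gt0. Qed.

Let sin_rpi_gt0 : 0 < sin (r * pi).
Proof. by rewrite sin_gt0_pi// mulr_gt0 ?pi_gt0//= gtr_pMl ?pi_gt0. Qed.

(** Each ratio (r + k) / (k + 1) lies in [0, 1]. The bound by 1 is what confines [mu] to [-1, 1]. *)
Lemma fuss_catalan_number_01 k : 0 <= fuss_catalan_number 1 r k <= 1.
Proof.
elim: k => [|k /andP[ih0 ih1]]; first by rewrite /fuss_catalan_number/= ler01 lexx.
have k0 : 0 <= r + k%:R by rewrite addr_ge0// ltW.
rewrite fuss_catalan_numberS mulr_ge0 ?divr_ge0//= mulr_ile1 ?divr_ge0//.
by rewrite ler_pdivrMr// mul1r -natr1 addrC lerD2l ltW.
Qed.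

(** Both sides have successive ratios (r + k) / (k + 1), because the parameters r + k and 1 - r sum
    to k + 1. *)
Lemma beta_integral_moment k :
  beta_integral (r + k%:R) (1 - r) =
  fuss_catalan_number 1 r k * beta_integral r (1 - r).
Proof.
elim: k => [|k ih]; first by rewrite addr0 /fuss_catalan_number/= mul1r.
rewrite -natr1 addrA beta_integralSl// ?ih ?fuss_catalan_numberS; last first.
  by rewrite ltr_wpDr.
by rewrite mulrA -[k.+1%:R]natr1; congr (_ / _ * _ * _); ring.
Qed.

Lemma W1E :
  W1 r = (fun x => sin (r * pi) / pi * beta_kernel r (1 - r) x) \_ `]0, 1[.
Proof.
apply/funext => x; rewrite /W1 patchE indicE /beta_kernel [1 - r - 1]addrAC subrr sub0r.
by case: ifP => _; rewrite ?mulr1 ?mulr0// mulrA.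
Qed.

Lemma W1_ge0 x : 0 <= W1 r x.
Proof.
rewrite W1E patchE; case: ifP => // _.
by rewrite mulr_ge0 ?beta_kernel_ge0// divr_ge0 ?pi_ge0// ltW.
Qed.

Lemma measurable_W1 : measurable_fun setT (W1 r).
Proof.
rewrite W1E; apply/(measurable_restrictT _ (measurable_itv _)).
by apply: measurable_funM => //; exact: measurable_beta_kernel.
Qed.

Let W1_momentE k x : x ^+ k * W1 r x =
  (fun y => sin (r * pi) / pi * beta_kernel (r + k%:R) (1 - r) y) \_ `]0, 1[ x.
Proof.
rewrite W1E !patchE; case: ifP => [|_]; last by rewrite mulr0.
rewrite mem_setE in_itv/= => /andP[x0 _].
rewrite mulrCA; congr (_ * _); rewrite /beta_kernel mulrA; congr (_ * _).
rewrite -powR_mulrn ?(ltW x0)// -powRD; first by congr (_ `^ _); ring.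
by rewrite (gt_eqF x0) implybT.
Qed.

Lemma integrable_W1_moment k :
  (@lebesgue_measure R).-integrable setT (fun x => (x ^+ k * W1 r x)%:E).
Proof.
rewrite (_ : (fun x => _) = (EFin \o (fun y =>
    sin (r * pi) / pi * beta_kernel (r + k%:R) (1 - r) y)) \_ `]0, 1[); last first.
  by apply/funext => x; rewrite W1_momentE !patchE; case: ifP.
apply: (iffLR (@integrable_mkcond _ _ _ lebesgue_measure `]0, 1[ _ _)).
  exact: measurable_itv.
apply: (@integrableZl _ _ _ lebesgue_measure `]0, 1[%classic (measurable_itv _)
  (sin (r * pi) / pi) (EFin \o beta_kernel (r + k%:R) (1 - r))).
by apply: integrable_beta_kernel => //; rewrite ltr_wpDr.
Qed.

Lemma Rintegral_W1_moment k :
  \int[lebesgue_measure]_x (x ^+ k * W1 r x) = fuss_catalan_number 1 r k.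
Proof.
transitivity (\int[lebesgue_measure]_(x in `]0, 1[)
    (sin (r * pi) / pi * beta_kernel (r + k%:R) (1 - r) x)).
  rewrite [RHS]Rintegral_mkcond; apply: eq_Rintegral => x _.
  exact: W1_momentE.
rewrite RintegralZl//; last first.
  by apply: integrable_beta_kernel => //; rewrite ltr_wpDr.
rewrite -/(beta_integral _ _) beta_integral_moment beta_integral_reflection//.
rewrite mulrCA -[X in _ * X](_ : 1 = _) ?mulr1//.
move: (@pi R) (sin _) (lt0r_neq0 sin_rpi_gt0) (lt0r_neq0 (pi_gt0 R)) => p s s0 p0.
by field; rewrite s0 p0.
Qed.

Lemma W1_support x : W1 r x != 0 -> `|x| <= 1.
Proof.
rewrite W1E patchE; case: ifP => [|_ /eqP//].
rewrite mem_setE in_itv/= => /andP[x0 x1] _.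
by rewrite gtr0_norm// ltW.
Qed.

Section distribution.
Variable mu : probability (measurableTypeR R) R.
Hypothesis hmu : forall k,
  (\int[mu]_x (x ^+ k)%:E = (fuss_catalan_number 1 r k)%:E)%E.

(** An even power is its own absolute value, so its finite moment makes it integrable. Every power
    then is, as |x^k| <= 1 + x^(2k). *)
Lemma integrable_moment k : mu.-integrable setT (fun x => (x ^+ k)%:E).
Proof.
have i2 : mu.-integrable setT (fun x => (x ^+ (k + k))%:E).
  apply/integrableP; split.
    by apply/measurable_EFinP; exact: measurable_funX.
  have := ltry (fuss_catalan_number 1 r (k + k)); rewrite -hmu.
  congr (_ < _)%E; apply: eq_integral => x _.
  by rewrite /= ger0_norm// exprD -expr2 sqr_ge0.
have i1 : mu.-integrable setT (EFin \o cst (1 : R)).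
  exact: finite_measure_integrable_cst.
apply: (le_integrable _ _ _ (integrableD measurableT i1 i2)) => //.
- by apply/measurable_EFinP; exact: measurable_funX.
move=> x _; rewrite /= lee_fin [leRHS]ger0_norm; last first.
  by rewrite exprD -expr2 addr_ge0// sqr_ge0.
rewrite exprD -expr2 -[_ ^+ 2]real_normK ?num_real//.
have := sqr_ge0 (`|x ^+ k| - 1); have := normr_ge0 (x ^+ k).
by move: (`|_|) => y; nra.
Qed.

(* Chebyshev: [a ^+ 2k * mu (|x| >= a)] is at most the moment of order [2k],
   which is at most [1]. *)
Lemma fuss_catalan_support : {ae mu, forall x : R, `|x| <= 1}.
Proof.
pose S (a : R) := [set x : measurableTypeR R | a <= `|x|].
have mS a : measurable (S a).
  rewrite /S -[X in measurable X]setTI.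
  exact: measurable_fun_le.
have S0 a : 1 < a -> mu (S a) = 0.
  move=> a1; have a0 : 0 < a by rewrite (lt_trans _ a1).
  have bnd k : a ^+ (k + k) * fine (mu (S a)) <= 1.
    rewrite -lee_fin EFinM fineK ?fin_num_measure//.
    apply: (@le_trans _ _ (\int[mu]_(x in S a) (a ^+ (k + k))%:E)%E).
      by rewrite integral_cst.
    apply: (@le_trans _ _ (\int[mu]_x (x ^+ (k + k))%:E)%E); last first.
      by rewrite hmu lee_fin; have /andP[] := fuss_catalan_number_01 (k + k).
    apply: (@le_trans _ _ (\int[mu]_(x in S a) (x ^+ (k + k))%:E)%E).
      apply: ge0_le_integral_nonmeasurable => x ax.
        by rewrite lee_fin exprn_ge0// ltW.
      rewrite lee_fin [leRHS](_ : _ = `|x| ^+ (k + k)).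
        by rewrite lerXn2r// nnegrE ltW.
      by rewrite !exprD -!expr2 -normrX real_normK ?num_real.
    apply: ge0_subset_integral => //.
    - by apply/measurable_EFinP; exact: measurable_funX.
    - by move=> x _; rewrite lee_fin exprD -expr2 sqr_ge0.
  have m0 : 0 <= fine (mu (S a)) by rewrite fine_ge0.
  apply/eqP; rewrite -[mu _]fineK ?fin_num_measure// eqe.
  rewrite eq_le m0 andbT leNgt; apply/negP => mpos.
  set c := fine _ in m0 mpos bnd.
  (* Choosing k > 1 / (c (a - 1)), Bernoulli gives c a^(2k) >= c (1 + 2k (a - 1)) > 2, against
     [bnd]. *)
  have ca : 0 < c * (a - 1) by rewrite mulr_gt0// subr_gt0.
  have := archi_boundP (ltW (divr_gt0 (@ltr01 R) ca)); rewrite ltr_pdivrMr//.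
  move: (Num.bound _) => k kc; have := bnd k.
  have a1' : -1 <= a - 1 by rewrite lerBrDl subrr ltW.
  have := bernoulli_ineq (k + k) a1'; rewrite subrKC natrD => h h'.
  have k0 : 0 <= k%:R * (c * (a - 1)) :> R by rewrite mulr_ge0// ltW.
  have := ler_wpM2r m0 h; lra.
have S_cover : ~` [set x : R | `|x| <= 1] `<=`
    \bigcup_n S (1 + n.+1%:R^-1).
  move=> x /= /negP; rewrite -ltNge => x1.
  have x10 : 0 < `|x| - 1 by rewrite subr_gt0.
  have [n _ /(_ n (leqnn n))/= hn] := near_infty_natSinv_lt (PosNum x10).
  by exists n => //; rewrite /S/= -lerBrDl ltW.
have S_negl : mu.-negligible (\bigcup_n S (1 + n.+1%:R^-1)).
  apply: negligible_bigcup => n.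
  by apply/negligibleP; [exact: mS|apply: S0; rewrite ltrDl].
have [N [mN N0 SN]] := S_negl.
by exists N; split => //; exact: subset_trans S_cover SN.
Qed.

Lemma is_density_W1 : is_density mu (W1 r).
Proof.
split; [exact: measurable_W1|exact: W1_ge0|].
pose nu := density_measure measurable_W1 W1_ge0.
have cdf (a : R) : mu `]-oo, a[%classic = nu `]-oo, a[%classic.
  have iW : (@lebesgue_measure R).-integrable `]-oo, a[ (EFin \o W1 r).
    have := integrable_W1_moment 0.
    rewrite (_ : (fun x => _) = EFin \o W1 r); last first.
      by apply/funext => x; rewrite mul1r.
    by move=> h; apply: integrableS h.
  (* The measure of the ray is written as the integral of the weight 1 to match the weighted form of
     [moments_determine_cdf]. *)
  have : \int[mu]_(x in `]-oo, a[) cst (1 : R) x =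
      \int[lebesgue_measure]_(x in `]-oo, a[) W1 r x.
    apply: moments_determine_cdf.
    - move=> k; rewrite (_ : (fun x => _) = (fun x => (x ^+ k)%:E)).
        exact: integrable_moment.
      by apply/funext => x; rewrite mulr1.
    - exact: integrable_W1_moment.
    - exact: (@filterS _ _ (ae_filter_ringOfSetsType mu) _ _ _
        fuss_catalan_support).
    - by apply: aeW => x; exact: W1_support.
    - move=> k; rewrite Rintegral_W1_moment /Rintegral.
      under eq_integral do rewrite mulr1.
      by rewrite hmu.
  rewrite Rintegral_cst// mul1r => h.
  rewrite -[LHS]fineK ?fin_num_measure// h /Rintegral fineK//.
  exact: (integrable_fin_num _ iW).
move=> A mA; apply: (@measure_eq_itvNyo R mu nu) => //.
by move=> a; rewrite -ge0_fin_numE// fin_num_measure.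
Qed.

End distribution.

End fuss_catalan.

(** * Non-unimodality *)

Lemma powRN_le (R : realType) (s x y : R) : 0 <= s -> 0 < x -> x <= y ->
  y `^ (- s) <= x `^ (- s).
Proof.
move=> s0 x0 xy; have y0 : 0 < y := lt_le_trans x0 xy.
rewrite !powRN lef_pV2 ?posrE ?powR_gt0//.
by apply: ge0_ler_powR => //; rewrite nnegrE ltW.
Qed.

Lemma powRN_unbounded (R : realType) (s C h0 : R) : 0 < s -> 0 < h0 ->
  exists2 h, 0 < h < h0 & C < h `^ (- s).
Proof.
move=> s0 h00; have C0 : 0 < `|C| + 1 by rewrite ltr_wpDl.
(* Solves t^(-s) = |C| + 1; any smaller positive point has a value at least as large, so the minimum
   with h0 / 2 works. *)
pose t := (`|C| + 1) `^ (- s^-1).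
have t0 : 0 < t by exact: powR_gt0.
exists (Num.min (h0 / 2) t).
  by rewrite lt_min gt_min t0 divr_gt0//= ltr_pdivrMr// ltr_pMr// ltr1n.
apply: (@lt_le_trans _ _ (t `^ (- s))).
  rewrite /t -powRrM mulrNN mulVf ?lt0r_neq0// powRr1 ?ltW//.
  by rewrite (le_lt_trans (ler_norm C))// ltrDl.
apply: powRN_le; first exact: ltW.
  by rewrite lt_min t0 divr_gt0.
by rewrite ge_min lexx orbT.
Qed.

Section not_unimodal.
Context {R : realType} (r : R).
Hypotheses (hr0 : 0 < r) (hr1 : r < 1).

Let K := sin (r * pi) / pi.

Let K_gt0 : 0 < K.
Proof.
by rewrite divr_gt0 ?pi_gt0// sin_gt0_pi// mulr_gt0 ?pi_gt0//= gtr_pMl ?pi_gt0.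
Qed.

Let W1_in01 x : 0 < x < 1 -> W1 r x = K * (x `^ (- (1 - r)) * (1 - x) `^ (- r)).
Proof.
move=> x01; rewrite /W1 indicE mem_set; last by rewrite /= in_itv.
by rewrite mulr1 opprB mulrA.
Qed.

Let powRN_ge1 (s x : R) : 0 <= s -> 0 < x < 1 -> 1 <= x `^ (- s).
Proof.
move=> s0 /andP[x0 x1]; have e : 1 `^ (- s) = 1 :> R by rewrite powR1.
rewrite -[leLHS]e.
by apply: powRN_le => //; exact: ltW.
Qed.

(** The factor that is not singular at this endpoint is at least 1 on []0, 1[], so the singular
    factor alone gives the bound. *)
Lemma W1_ge_near1 h x : 0 < h < 1 -> 1 - h < x < 1 -> K * h `^ (- r) <= W1 r x.
Proof.
move=> /andP[h0 h1] /andP[hx x1].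
have x0 : 0 < x by rewrite (lt_trans _ hx)// subr_gt0.
rewrite W1_in01 ?x0// ler_pM2l// -[leLHS]mul1r ler_pM ?powR_ge0//.
  by rewrite powRN_ge1 ?x0// subr_ge0 ltW.
by apply: powRN_le; rewrite ?ltW ?subr_gt0//; lra.
Qed.

Lemma W1_ge_near0 h x : 0 < h < 1 -> 0 < x < h ->
  K * h `^ (- (1 - r)) <= W1 r x.
Proof.
move=> /andP[h0 h1] /andP[x0 xh].
have x1 : x < 1 by exact: lt_trans h1.
rewrite W1_in01 ?x0// ler_pM2l// -[leLHS]mulr1 ler_pM ?powR_ge0//.
  by apply: powRN_le; rewrite ?subr_ge0 ?ltW.
by rewrite powRN_ge1 ?ltW// subr_gt0 x1 gtrBl.
Qed.

Lemma W1_not_unimodal (mu : {measure set (measurableTypeR R) -> \bar R}) :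
  is_density mu (W1 r) -> ~ unimodal mu.
Proof.
move=> [mW W0 muE] [a [c [f [c0 f0 f_incr f_decr rhoE]]]].
(* Comparing masses avoids pointwise equality of [f] and [W1 r]: on an interval missing the mode the
   atom does not contribute, so L (v - u) <= mu ]u, v[ <= C (v - u). *)
have sandwich (u v L C : R) : u < v -> ~ (u < a < v) -> 0 <= L ->
    (forall x, u < x < v -> L <= W1 r x) ->
    (forall x, u < x < v -> f x <= C) -> L <= C.
  move=> uv auv L0 LW fC.
  have vu0 : 0 < v - u by rewrite subr_gt0.
  have leb : lebesgue_measure `]u, v[%classic = (v - u)%:E :> \bar R.
    by rewrite lebesgue_measure_itv/= lte_fin uv EFinB.
  rewrite -(ler_pM2r vu0) -lee_fin !EFinM -leb.
  rewrite -!(@integral_cst _ _ _ lebesgue_measure `]u, v[%classic)//.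
  apply: (@le_trans _ _ (mu `]u, v[%classic)).
    rewrite muE//; apply: ge0_le_integral_nonmeasurable => x/=; rewrite ?lee_fin//.
    by rewrite in_itv/=; exact: LW.
  rewrite rhoE// diracE memNset ?mule0 ?add0e; last by rewrite /= in_itv.
  apply: ge0_le_integral_nonmeasurable => x/=; rewrite lee_fin//.
  by rewrite in_itv/=; exact: fC.
have [a1|a1] := ltP a 1.
  (* A point of []0, 1[] beyond the mode: [f] is at most [f p] to its right, while [W1 r] exceeds
     [f p] on some []1 - h, 1[] with h < 1 - p. *)
  pose p := (Num.max a 0 + 1) / 2.
  have m1 : Num.max a 0 < 1 by rewrite gt_max a1 ltr01.
  have ma : a <= Num.max a 0 by rewrite le_max lexx.
  have m0 : 0 <= Num.max a 0 by rewrite le_max lexx orbT.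
  have [pa [p0 p1]] : a < p /\ 0 < p /\ p < 1 by rewrite /p; lra.
  have p10 : 0 < 1 - p by rewrite subr_gt0.
  have [h /andP[h0 hp] hC] := powRN_unbounded (f p / K) hr0 p10.
  move: hC; rewrite ltr_pdivrMr// mulrC ltNge => /negP; apply.
  apply: (@sandwich (1 - h) 1).
  - by rewrite gtrBl.
  - by move=> /andP[]; lra.
  - by rewrite mulr_ge0 ?powR_ge0// ltW.
  - by move=> x; apply: W1_ge_near1; rewrite h0; lra.
  - by move=> x /andP[x0 x1]; apply: f_decr; rewrite ?in_itv/=; lra.
(* Here the mode is at least 1, so 1/2 lies below it and [f] is at most [f p] on []0, h[] for h <
   1/2, where [W1 r] becomes larger. *)
pose p := 2^-1 : R.
have p0 : 0 < p by rewrite invr_gt0.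
have r10 : 0 < 1 - r by rewrite subr_gt0.
have [h /andP[h0 hp] hC] := powRN_unbounded (f p / K) r10 p0.
have p1 : p < 1 by rewrite invf_lt1// ltr1n.
move: hC; rewrite ltr_pdivrMr// mulrC ltNge => /negP; apply.
apply: (@sandwich 0 h) => //.
- by move=> /andP[]; lra.
- by rewrite mulr_ge0 ?powR_ge0// ltW.
- by move=> x; apply: W1_ge_near0; rewrite h0; lra.
- by move=> x /andP[x0 x1]; apply: f_incr; rewrite ?in_itv/=; lra.
Qed.

End not_unimodal.

Theorem proposition4p7 (R : realType) (r : R) (hr0 : 0 < r) (hr1 : r < 1)
    (mu : probability (measurableTypeR R) R) (hmu : is_fuss_catalan 1 r mu) :
  is_density mu (W1 r) /\ ~ unimodal mu.
Proof.
have dW : is_density mu (W1 r) by apply: is_density_W1 => //; exact: hmu.2.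
by split; [exact: dW|exact: (W1_not_unimodal hr0 hr1 dW)].
Qed.
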